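(* Let $p$ be a prime, $\alpha \geq 1$, and let $P \in \mathbb{Z}_p[x, y]$ satisfy $P(0, 0) = 0$ and $\frac{\partial P}{\partial y}(0, 0) \not\equiv 0 \bmod p$. Let $Q$ and the set of states $\mathcal{M}_{p^\alpha}$ be as defined in the context. Then every state in $\mathcal{M}_{p^\alpha}$ has a unique base-$\frac{p}{Q}$ representation.
   Context: Write $\mathcal{R}_{p^\alpha} = \mathbb{Z}/p^\alpha\mathbb{Z}$. Let $Q \in \mathcal{R}_{p^\alpha}[x, y, y^{-1}]$ be a lift of $P/y \bmod p$ having the same monomial support as $P/y \bmod p$. Cartier operators: for $r, s \in \{0, \dots, p-1\}$, $\Lambda_{r, s}$ is the $\mathcal{R}_{p^\alpha}$-linear operator on Laurent polynomials with $\Lambda_{r, s}(x^m y^n) = x^{(m - r)/p} y^{(n - s)/p}$ if $m \equiv r$ and $n \equiv s \bmod p$, and $0$ otherwise. For $S \in \mathcal{R}_{p^\alpha}[x, y, y^{-1}]$ put $\lambda_{r, 0}(S) := \Lambda_{r, 0}(S Q^{p^\alpha - p^{\alpha - 1}})$. States: $S_0 := \big(y \frac{\partial P}{\partial y} (P/y)^{p^{\alpha - 1} - 1} \bmod p^\alpha\big)$, and $\mathcal{M}_{p^\alpha}$ is the smallest subset of $\mathcal{R}_{p^\alpha}[x, y, y^{-1}]$ that contains $S_0$ and is closed under $\lambda_{r, 0}$ for all $r \in \{0, \dots, p-1\}$. Base-$\frac{p}{Q}$ representations: let $D = \{0, 1, \dots, p-1\} \subseteq \mathcal{R}_{p^\alpha}$,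 and let $D[x, y, y^{-1}]$ be the set of Laurent polynomials all of whose coefficients lie in $D$. A base-$\frac{p}{Q}$ representation of $S \in \mathcal{R}_{p^\alpha}[x, y, y^{-1}]$ is a tuple $(T_{\alpha - 1}, \dots, T_1, T_0)$ with each $T_k \in D[x, y, y^{-1}]$ and $$S = \Big(\sum_{k = 0}^{\alpha - 1} T_k (\tfrac{p}{Q})^k\Big) Q^{p^{\alpha - 1} - 1} = \sum_{k=0}^{\alpha-1} T_k\, p^k Q^{p^{\alpha - 1} - 1 - k}$$ in $\mathcal{R}_{p^\alpha}[x, y, y^{-1}]$ (the exponents of $Q$ are nonnegative since $p^{\alpha - 1} - 1 \geq \alpha - 1$). *)

(* Defs.v *)
From HB Require Import structures.
From mathcomp Require Import all_boot all_order all_algebra.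
From mathcomp Require Import finmap boolp.
From mathcomp.multinomials Require Import monalg.

Set Implicit Arguments.
Unset Strict Implicit.
Unset Printing Implicit Defensive.

Import GRing.Theory.
Local Open Scope ring_scope.

(* Reduction Z/m -> Z/n through the least nonnegative representative; it is a
   ring morphism when n divides m, the only case in which it is used. *)
Definition Zp_red (m n : nat) (a : 'Z_m) : 'Z_n := inZp a.

Section ZpRed.
Variables m n : nat.
Hypothesis dvd_nm : ((Zp_trunc n).+2 %| (Zp_trunc m).+2)%N.
Local Notation red := (@Zp_red m n).

Lemma Zp_red0 : red 0 = 0. Proof. exact/val_inj. Qed.

Lemma Zp_red1 : red 1 = 1. Proof. by apply/val_inj; rewrite /= !modn_small. Qed.

Lemma Zp_redD : {morph red : a b / a + b}.
Proof. by move=> a b; apply/val_inj; rewrite /= modn_dvdm // modnDm. Qed.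

Lemma Zp_redM : {morph red : a b / a * b}.
Proof. by move=> a b; apply/val_inj; rewrite /= modn_dvdm // modnMm. Qed.

Lemma Zp_redN : {morph red : a / - a}.
Proof.
move=> a; apply: (addrI (red a)); rewrite subrr -Zp_redD subrr.
exact: Zp_red0.
Qed.
End ZpRed.

Lemma dvd_Zp_truncX p k :
  ((Zp_trunc (p ^ k.+1)).+2 %| (Zp_trunc (p ^ k.+2)).+2)%N.
Proof.
case: p => [|[|p]]; rewrite ?exp1n ?exp0n //.
by rewrite !Zp_cast ?dvdn_exp2l // -[1%N](expn0 p.+2) ltn_exp2l.
Qed.

(* The p-adic integers Z_p, as the inverse limit of the rings Z/p^(k+1), k >= 0.
   The index starts at p^1 because 'Z_1 is not the trivial ring. *)
Record padic_int (p : nat) := PadicInt {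
  padic_res : forall k, 'Z_(p ^ k.+1);
  padic_coh : forall k, Zp_red _ (padic_res k.+1) = padic_res k
}.

HB.instance Definition _ p := gen_eqMixin (padic_int p).
HB.instance Definition _ p := gen_choiceMixin (padic_int p).

Section PadicRing.
Variable p : nat.
Local Notation Zp := (padic_int p).
Implicit Types u v w : Zp.

Lemma padicP u v : (forall k, padic_res u k = padic_res v k) -> u = v.
Proof.
case: u v => [u cu] [v cv] /= uv.
have {uv} uv : u = v by exact: functional_extensionality_dep.
by subst v; congr PadicInt; exact: Prop_irrelevance.
Qed.

Definition padic_zero : Zp :=
  @PadicInt p (fun=> 0) (fun k => Zp_red0 _ _).
Definition padic_one : Zp :=
  @PadicInt p (fun=> 1) (fun k => Zp_red1 _ _).

Fact padic_add_coh u v k :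
  Zp_red _ (padic_res u k.+1 + padic_res v k.+1) = padic_res u k + padic_res v k.
Proof. by rewrite Zp_redD ?padic_coh //; exact: dvd_Zp_truncX. Qed.
Definition padic_add u v : Zp := PadicInt (padic_add_coh u v).

Fact padic_mul_coh u v k :
  Zp_red _ (padic_res u k.+1 * padic_res v k.+1) = padic_res u k * padic_res v k.
Proof. by rewrite Zp_redM ?padic_coh //; exact: dvd_Zp_truncX. Qed.
Definition padic_mul u v : Zp := PadicInt (padic_mul_coh u v).

Fact padic_opp_coh u k : Zp_red _ (- padic_res u k.+1) = - padic_res u k.
Proof. by rewrite Zp_redN ?padic_coh //; exact: dvd_Zp_truncX. Qed.
Definition padic_opp u : Zp := PadicInt (padic_opp_coh u).

Fact padic_addA : associative padic_add.
Proof. by move=> u v w; apply/padicP => k /=; rewrite addrA. Qed.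
Fact padic_addC : commutative padic_add.
Proof. by move=> u v; apply/padicP => k /=; rewrite addrC. Qed.
Fact padic_add0 : left_id padic_zero padic_add.
Proof. by move=> u; apply/padicP => k /=; rewrite add0r. Qed.
Fact padic_addN : left_inverse padic_zero padic_opp padic_add.
Proof. by move=> u; apply/padicP => k /=; rewrite addNr. Qed.
Fact padic_mulA : associative padic_mul.
Proof. by move=> u v w; apply/padicP => k /=; rewrite mulrA. Qed.
Fact padic_mulC : commutative padic_mul.
Proof. by move=> u v; apply/padicP => k /=; rewrite mulrC. Qed.
Fact padic_mul1 : left_id padic_one padic_mul.
Proof. by move=> u; apply/padicP => k /=; rewrite mul1r. Qed.
Fact padic_mulD : left_distributive padic_mul padic_add.
Proof. by move=> u v w; apply/padicP => k /=; rewrite mulrDl. Qed.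
Fact padic_one_neq0 : padic_one != padic_zero.
Proof.
apply/eqP => /(congr1 (fun u => padic_res u 0)) /= /eqP.
by rewrite oner_eq0.
Qed.

HB.instance Definition _ := GRing.isZmodule.Build Zp
  padic_addA padic_addC padic_add0 padic_addN.
HB.instance Definition _ := GRing.Zmodule_isComNzRing.Build Zp
  padic_mulA padic_mulC padic_mul1 padic_mulD padic_one_neq0.
End PadicRing.

(* The reduction Z_p -> Z/p^k for k >= 1.  The component at index k is the
   residue modulo p^(k+1), hence the further reduction to Z/p^k. *)
Definition padic_mod (p k : nat) (u : padic_int p) : 'Z_(p ^ k) :=
  Zp_red (p ^ k) (padic_res u k).

(* R[x, y, y^-1]: finitely supported functions on the exponents (m, n) of the
   monomials x^m y^n, with m a natural number and n an integer.  The product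
   of monalg is not available since it excludes invertible monomials. *)
Definition laurent (R : comNzRingType) : Type := {malg R[(nat * int)%type]}.

HB.instance Definition _ (R : comNzRingType) := GRing.Zmodule.on (laurent R).
HB.instance Definition _ (R : comNzRingType) := GRing.Lmodule.on (laurent R).

Definition lmonom {R : comNzRingType} (c : R) (k : nat * int) : laurent R :=
  << c *g k >>.

Section LaurentRing.
Variable R : comNzRingType.
Local Notation L := (laurent R).
Local Notation K := (nat * int)%type.
Implicit Types (f g h : L) (k : K).

Definition laurent_mul f g : L :=
  \sum_(k <- msupp f) \sum_(l <- msupp g) lmonom (f@_k * g@_l) (k + l).

Local Notation "f *L g" := (laurent_mul f g) (at level 40).

Fact lmonom0 k : lmonom (0 : R) k = 0. Proof. exact: monalgU0. Qed.
Fact lmonomD k : {morph (@lmonom R)^~ k : a b / a + b}.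
Proof. exact: monalgUD. Qed.

Fact laurent_mulE (A B : {fset K}) f g :
  (msupp f `<=` A)%fset -> (msupp g `<=` B)%fset ->
  f *L g = \sum_(k <- A) \sum_(l <- B) lmonom (f@_k * g@_l) (k + l).
Proof.
move=> fA gB; rewrite /laurent_mul (big_fset_incl _ fA) /=.
  apply: eq_bigr => k _; apply: (big_fset_incl _ gB) => l _ /mcoeff_outdom ->.
  by rewrite mulr0 lmonom0.
move=> k _ /mcoeff_outdom fk.
by rewrite big1 // => l _; rewrite fk mul0r lmonom0.
Qed.

Fact laurent_mulC : commutative laurent_mul.
Proof.
move=> f g; rewrite /laurent_mul exchange_big /=.
by apply: eq_bigr => l _; apply: eq_bigr => k _; rewrite mulrC addrC.
Qed.

Fact laurent_mulDl : left_distributive laurent_mul +%R.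
Proof.
move=> f g h.
rewrite (laurent_mulE (msuppD_le f g) (fsubset_refl (msupp h))).
rewrite (laurent_mulE (fsubsetUl (msupp f) (msupp g)) (fsubset_refl (msupp h))).
rewrite (laurent_mulE (fsubsetUr (msupp f) (msupp g)) (fsubset_refl (msupp h))).
rewrite -big_split /=; apply: eq_bigr => k _.
rewrite -big_split /=; apply: eq_bigr => l _.
by rewrite mcoeffD mulrDl lmonomD.
Qed.

Fact laurent_mulDr : right_distributive laurent_mul +%R.
Proof. by move=> f g h; rewrite !(laurent_mulC f) laurent_mulDl. Qed.

Fact laurent_mul0l : left_zero 0 laurent_mul.
Proof. by move=> f; rewrite /laurent_mul msupp0 big_seq_fset0. Qed.

Fact laurent_mul0r : right_zero 0 laurent_mul.
Proof. by move=> f; rewrite laurent_mulC laurent_mul0l. Qed.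

Fact laurent_mulMM a b k l :
  lmonom a k *L lmonom b l = lmonom (a * b) (k + l).
Proof.
rewrite (laurent_mulE (@msuppU_le _ _ k a) (@msuppU_le _ _ l b)).
by rewrite !big_seq_fset1 !mcoeffUU.
Qed.

Fact laurentE f : f = \sum_(k <- msupp f) lmonom f@_k k.
Proof. exact: monalgE. Qed.

Fact laurent_mul_suml (s : seq K) (F : K -> L) g :
  (\sum_(k <- s) F k) *L g = \sum_(k <- s) F k *L g.
Proof.
exact: (big_morph (laurent_mul^~ g) (fun _ _ => laurent_mulDl _ _ _)
  (laurent_mul0l _)).
Qed.

Fact laurent_mul_sumr (s : seq K) (F : K -> L) f :
  f *L (\sum_(k <- s) F k) = \sum_(k <- s) f *L F k.
Proof.
exact: (big_morph (laurent_mul f) (fun _ _ => laurent_mulDr _ _ _)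
  (laurent_mul0r _)).
Qed.

Fact laurent_mulA : associative laurent_mul.
Proof.
move=> f g h; rewrite (laurentE f).
rewrite (laurent_mul_suml _ _ (g *L h)) (laurent_mul_suml _ _ g).
rewrite (laurent_mul_suml _ _ h); apply: eq_bigr => k _.
rewrite (laurentE g) (laurent_mul_suml _ _ h) (laurent_mul_sumr _ _ (lmonom _ k)).
rewrite (laurent_mul_sumr _ _ (lmonom _ k)) (laurent_mul_suml _ _ h).
apply: eq_bigr => l _; rewrite (laurentE h).
rewrite (laurent_mul_sumr _ _ (lmonom _ l)) (laurent_mul_sumr _ _ (lmonom _ k)).
rewrite (laurent_mul_sumr _ _ (lmonom _ k *L lmonom _ l)).
by apply: eq_bigr => j _; rewrite !laurent_mulMM mulrA addrA.
Qed.

Fact laurent_mul1 : left_id (lmonom 1 0) laurent_mul.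
Proof.
move=> f; rewrite {1}(laurentE f) laurent_mul_sumr [RHS]laurentE.
by apply: eq_bigr => k _; rewrite laurent_mulMM mul1r add0r.
Qed.

Fact laurent_one_neq0 : lmonom (1 : R) 0 != 0.
Proof. by rewrite /lmonom monalgU_eq0 oner_eq0. Qed.

HB.instance Definition _ := GRing.Zmodule_isComNzRing.Build L
  laurent_mulA laurent_mulC laurent_mul1 laurent_mulDl laurent_one_neq0.
End LaurentRing.

Definition lmap (R S : comNzRingType) (f : R -> S) (g : laurent R) : laurent S :=
  \sum_(k <- msupp g) lmonom (f g@_k) k.

(* R[x, y] is {poly {poly R}}: the inner variable is x, the outer one is y.
   Hence P^`() is the partial derivative in y, and P.[0].[0] is P(0, 0). *)
Definition poly_to_laurent (R : comNzRingType) (P : {poly {poly R}}) : laurent R :=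
  \sum_(n < size P) \sum_(m < size P`_n) lmonom P`_n`_m (nat_of_ord m, n%:Z).

Definition lY {R : comNzRingType} : laurent R := lmonom 1 (0%N, 1).
Definition lYinv {R : comNzRingType} : laurent R := lmonom 1 (0%N, -1).

Definition div_y (R : comNzRingType) (P : {poly {poly R}}) : laurent R :=
  lYinv * poly_to_laurent P.

Definition cartier (R : comNzRingType) (p r s : nat) (S : laurent R) : laurent R :=
  \sum_(k <- msupp S)
    if (k.1 == r %[mod p])%N && (k.2 == s%:Z %[mod p%:Z])%Z
    then lmonom S@_k (((k.1 - r) %/ p)%N, ((k.2 - s%:Z)%R %/ p%:Z)%Z)
    else 0.

Section States.
Variables p alpha : nat.
Local Notation Ra := 'Z_(p ^ alpha).
Implicit Types (P : {poly {poly padic_int p}}) (Q S : laurent Ra).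

Definition is_lift P Q : Prop :=
  let Pbar := lmap (@padic_mod p 1) (div_y P) in
  lmap (@Zp_red (p ^ alpha) (p ^ 1)) Q = Pbar /\ msupp Q = msupp Pbar.

Definition lambda0 Q (r : nat) S : laurent Ra :=
  cartier p r 0 (S * Q ^+ (p ^ alpha - p ^ (alpha - 1))).

Definition init_state P : laurent Ra :=
  lmap (@padic_mod p alpha)
    (lY * poly_to_laurent P^`() * div_y P ^+ (p ^ (alpha - 1) - 1)).

Inductive is_state P Q : laurent Ra -> Prop :=
| state_init : is_state P Q (init_state P)
| state_step r S : (r < p)%N -> is_state P Q S -> is_state P Q (lambda0 Q r S).

Definition digits : seq Ra := [seq d%:R | d <- iota 0 p].

Definition is_base_repr Q S (T : {ffun 'I_alpha -> laurent Ra}) : Prop :=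
  (forall (k : 'I_alpha) (e : nat * int), (T k)@_e \in digits) /\
  S = \sum_(k < alpha) T k * p%:R ^+ k * Q ^+ (p ^ (alpha - 1) - 1 - k).
End States.

(* Main.v *)
(* Put N = p^(alpha-1) - 1.  The states lie in the ideal spanned by the
   p^k Q^(N-k), k < alpha.  For the initial state, expand (P/y)^N with
   P/y = Q + p U.  For the closure under lambda_{r,0}, write
   Q^(N-k) Q^(p^alpha - p^(alpha-1)) = (Q^p)^(N-k) Q^((p-1)(k+1)) and expand
   Q^p = Q(x^p, y^p) + p V: the powers of Q(x^p, y^p) leave the Cartier
   operator as powers of Q.  In that ideal, carrying p into Q yields
   digits in D, and they are unique because Q is not a zero divisor mod p:
   its constant coefficient is dP/dy(0, 0). *)

From HB Require Import structures.
Require Import Defs.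
From mathcomp Require Import all_boot all_order all_algebra all_field.
From mathcomp Require Import finmap.
From mathcomp.multinomials Require Import monalg.
From mathcomp Require Import zify ring.

Set Implicit Arguments.
Unset Strict Implicit.
Unset Printing Implicit Defensive.

Import GRing.Theory.
Local Open Scope ring_scope.

(** Binomial expansion of [(q ^+ p) ^+ m]. It serves with [s] equal to [Q(x^p, y^p)]: the [i]-th
    term gains [pi ^+ i] exactly as it loses [s ^+ i], which is the balance between powers of [p]
    and of [Q] in a base representation. *)
Lemma expand_exp_congr (A : comNzRingType) (t pi q s v : A) (p k m l e : nat) :
  q ^+ p = s + pi * v -> (m + l = p * m + e)%N ->
  t * pi ^+ k * q ^+ m * q ^+ l =
  \sum_(i < m.+1) pi ^+ (k + i) *
    (t * q ^+ e * v ^+ i * 'C(m, i)%:R * s ^+ (m - i)).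
Proof.
move=> qpE expE; rewrite -mulrA -exprD expE exprD exprM qpE exprDn.
rewrite mulrC -mulrA mulr_suml; apply: eq_bigr => i _.
by rewrite -mulr_natr exprMn exprD; ring.
Qed.

(** * Expansions in base [pi / q] over a commutative ring *)

Section BaseExpansion.
Variables (A : comNzRingType) (pi q : A) (n N : nat).
Hypotheses (pi_nil : pi ^+ n = 0) (leqnN : (n <= N.+1)%N).

(** Membership in the ideal spanned by the [pi ^+ k * q ^+ (N - k)], with no digit condition.
    Indexing [T] by [nat] lets a carry pass from one position to the next. *)
Definition base_span (S : A) : Prop :=
  exists T : nat -> A, S = \sum_(0 <= k < n) T k * pi ^+ k * q ^+ (N - k).

Lemma base_span0 : base_span 0.
Proof. by exists (fun=> 0); rewrite big1 // => k _; rewrite !mul0r. Qed.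

Lemma base_spanD S S' : base_span S -> base_span S' -> base_span (S + S').
Proof.
move=> [T ->] [T' ->]; exists (fun k => T k + T' k).
by rewrite -big_split /=; apply: eq_bigr => k _; rewrite !mulrDl.
Qed.

Lemma base_span_sum (I : Type) (r : seq I) (P : pred I) (F : I -> A) :
  (forall i, P i -> base_span (F i)) -> base_span (\sum_(i <- r | P i) F i).
Proof. exact: (big_ind _ base_span0 base_spanD). Qed.

(** No bound on [k] is required: from [n] on, [pi ^+ k] vanishes, so a truncated [N - k] does no
    harm. *)
Lemma base_span_term k U : base_span (U * pi ^+ k * q ^+ (N - k)).
Proof.
have [ltkn|lenk] := ltnP k n; last first.
  rewrite -(subnKC lenk) exprD pi_nil mul0r mulr0 mul0r; exact: base_span0.
exists (fun i => if i == k then U else 0).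
rewrite (bigD1_seq k) ?mem_index_iota ?iota_uniq //= eqxx big1 ?addr0 // => i.
by move=> /negPf ->; rewrite !mul0r.
Qed.

Lemma base_span_mul_exprD U v : base_span (U * (q + pi * v) ^+ N).
Proof.
rewrite exprDn mulr_sumr; apply: base_span_sum => i _.
have -> : U * (q ^+ (N - i) * (pi * v) ^+ i *+ 'C(N, i)) =
    (U * v ^+ i * 'C(N, i)%:R) * pi ^+ i * q ^+ (N - i).
  by rewrite -mulr_natr exprMn; ring.
exact: base_span_term.
Qed.

Variable D : A -> Prop.
Hypothesis D_div : forall u, exists d v, D d /\ u = d + pi * v.

(** Positions are normalized from [0] upwards: each coefficient is split as a digit plus a multiple
    of [pi], and the multiple is carried to the next position. The carry out of the last position is
    killed by [pi ^+ n = 0]. *)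
Lemma base_expansion_exists S : base_span S ->
  exists T : {ffun 'I_n -> A}, (forall k, D (T k)) /\
    S = \sum_(k < n) T k * pi ^+ k * q ^+ (N - k).
Proof.
suff carry m j (T : nat -> A) : (j + m = n)%N ->
    exists T' : nat -> A, (forall k, D (T' k)) /\
      \sum_(j <= k < n) T k * pi ^+ k * q ^+ (N - k) =
      \sum_(j <= k < n) T' k * pi ^+ k * q ^+ (N - k).
  move=> [T ->]; have [T' [DT' ->]] := carry n 0%N T (add0n n).
  exists [ffun k : 'I_n => T' k]; split=> [k|]; first by rewrite ffunE.
  by rewrite big_mkord; apply: eq_bigr => k _; rewrite ffunE.
elim: m j T => [|m IHm] j T jn.
  (* Both sums are empty, but [T'] must still take values in [D]; splitting [0] provides one. *)
  have [d [_ [Dd _]]] := D_div 0; exists (fun=> d); split=> //.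
  by rewrite !big_geq //; lia.
have ltjn : (j < n)%N by lia.
(* The carry: [v * pi] at index [j] is [v * q] at index [j.+1]. *)
have [d [v [Dd Tj]]] := D_div (T j).
pose T1 k := if k == j.+1 then T k + v * q else T k.
have [|T' [DT' eT']] := IHm j.+1 T1; first by lia.
exists (fun k => if k == j then d else T' k); split.
  by move=> k; case: eqP.
rewrite !(big_ltn ltjn) eqxx Tj !mulrDl -addrA; congr (_ + _).
rewrite [RHS](eq_big_nat _ _ (F2 := fun k => T' k * pi ^+ k * q ^+ (N - k)));
  last by move=> k /andP[ltjk _]; rewrite gtn_eqF.
rewrite -eT'; have [ltj1n|] := ltnP j.+1 n; last first.
  move=> lenj; have nE : n = j.+1 by lia.
  rewrite !big_geq // !addr0.
  have -> : pi * v * pi ^+ j = v * pi ^+ n by rewrite nE exprS mulrA (mulrC v).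
  by rewrite pi_nil mulr0 mul0r.
rewrite !(big_ltn ltj1n) {1}/T1 eqxx !mulrDl !addrA; congr (_ + _); last first.
  by apply: eq_big_nat => k /andP[ltjk _]; rewrite /T1 gtn_eqF.
rewrite addrC; congr (_ + _).
(* The subtraction is not truncated, since [j.+1 < n <= N.+1]. *)
have -> : (N - j = (N - j.+1).+1)%N by lia.
by rewrite !exprS; ring.
Qed.

Hypothesis D_inj : forall d d' v, D d -> D d' -> d - d' = pi * v -> d = d'.
Hypothesis pi_reg :
  forall k u, (k < n)%N -> pi ^+ k * u = 0 -> exists v, u = pi * v.
Hypothesis q_reg : forall u v, u * q = pi * v -> exists w, u = pi * w.

(** Once the digits below [k] agree, the difference of the two sums is divisible by [pi ^+ k].
    Cancelling that power leaves a congruence modulo [pi], where the power of [q] cancels as well;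
    digits congruent modulo [pi] are equal. *)
Lemma base_expansion_uniq (T T' : {ffun 'I_n -> A}) :
  (forall k, D (T k)) -> (forall k, D (T' k)) ->
  \sum_(k < n) T k * pi ^+ k * q ^+ (N - k) =
    \sum_(k < n) T' k * pi ^+ k * q ^+ (N - k) -> T = T'.
Proof.
move=> DT DT' eTT'; suff eqT m (k : 'I_n) : (k < m)%N -> T k = T' k.
  by apply/ffunP => k; apply: eqT (ltnSn k).
elim: m k => // m IHm k; rewrite ltnS leq_eqVlt => /predU1P[km|]; last exact: IHm.
have q_reg_exp i u v : u * q ^+ i = pi * v -> exists w, u = pi * w.
  elim: i v => [v|i IHi v]; first by rewrite mulr1; exists v.
  by rewrite exprSr mulrA => /q_reg[w /IHi].
(* Terms below [k] vanish by induction; those above [k] are divisible by [pi ^+ k.+1] and are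
   collected in [Z]. *)
have [Z eZ] : exists Z, \sum_(i < n) (T i - T' i) * pi ^+ i * q ^+ (N - i) =
    pi ^+ k * ((T k - T' k) * q ^+ (N - k) + pi * Z).
  exists (\sum_(i < n | (k < i)%N)
            (T i - T' i) * pi ^+ (i - k.+1) * q ^+ (N - i)).
  rewrite (bigD1 k) //= mulrDr; congr (_ + _).
    by rewrite mulrA [in RHS](mulrC (pi ^+ k)).
  rewrite mulrA -exprSr mulr_sumr big_mkcond [in RHS]big_mkcond.
  apply: eq_bigr => i _; case: (ltngtP i k) => [ik|ki|/val_inj ->].
  - by rewrite IHm -?km // subrr !mul0r if_same.
  - rewrite neq_ltn ki orbT !mulrA; congr (_ * _).
    rewrite -[RHS]mulrA mulrCA -exprD.
    by rewrite subnKC.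
  - by rewrite eqxx.
have /(@pi_reg k _ (ltn_ord k))[v ev] :
    pi ^+ k * ((T k - T' k) * q ^+ (N - k) + pi * Z) = 0.
  rewrite -eZ (eq_bigr (fun i : 'I_n => T i * pi ^+ i * q ^+ (N - i) -
    T' i * pi ^+ i * q ^+ (N - i))); last by move=> i _; rewrite !mulrBl.
  by rewrite sumrB eTT' subrr.
have /q_reg_exp[w ew] : (T k - T' k) * q ^+ (N - k) = pi * (v - Z).
  by rewrite mulrBr -ev addrK.
exact: D_inj ew.
Qed.
End BaseExpansion.

(** * Laurent polynomials: maps defined monomial by monomial, coefficients, products *)

Section LaurentSums.
Variables (R : comNzRingType) (V : zmodType) (phi : nat * int -> R -> V).
Hypothesis phiD : forall k, {morph phi k : a b / a + b}.

Let phi0 k : phi k 0 = 0.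
Proof. by apply: (addrI (phi k 0)); rewrite -phiD !addr0. Qed.

Lemma laurent_sum_fset (A : {fset nat * int}) (f : laurent R) :
  (msupp f `<=` A)%fset ->
  \sum_(k <- msupp f) phi k f@_k = \sum_(k <- A) phi k f@_k.
Proof.
by move=> fA; apply: (big_fset_incl _ fA) => k _ /mcoeff_outdom ->.
Qed.

(** Since [phi k 0 = 0], all three sums can be taken over the union of the supports. This yields the
    additivity of [lmap], [lfrob] and [cartier]. *)
Lemma laurent_sum_is_nmod_morphism :
  nmod_morphism (fun f : laurent R => \sum_(k <- msupp f) phi k f@_k).
Proof.
split=> [|f g]; first by rewrite msupp0 big_seq_fset0.
rewrite (laurent_sum_fset (msuppD_le f g)).
rewrite (laurent_sum_fset (fsubsetUl (msupp f) (msupp g))).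
rewrite (laurent_sum_fset (fsubsetUr (msupp f) (msupp g))) -big_split /=.
by apply: eq_bigr => k _; rewrite mcoeffD phiD.
Qed.

Lemma laurent_sum_monom c k :
  \sum_(l <- msupp (lmonom c k)) phi l (lmonom c k)@_l = phi k c.
Proof.
by rewrite (laurent_sum_fset msuppU_le) big_seq_fset1 /lmonom mcoeffUU.
Qed.
End LaurentSums.

Section LaurentTheory.
Variable R : comNzRingType.
Implicit Types (f g : laurent R) (k : nat * int).

Lemma laurent_ind (P : laurent R -> Prop) :
  P 0 -> (forall f g, P f -> P g -> P (f + g)) -> (forall c k, P (lmonom c k)) ->
  forall f, P f.
Proof.
by move=> P0 PD PU f; rewrite (laurentE f); apply: (big_ind P) => // k _.
Qed.

Lemma lmonomM (a b : R) k l : lmonom a k * lmonom b l = lmonom (a * b) (k + l).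
Proof. exact: laurent_mulMM. Qed.

Lemma lmonomMn (a : R) k n : lmonom (a *+ n) k = lmonom a k *+ n.
Proof. exact: monalgUMn. Qed.

Lemma lmonomX (a : R) k n : lmonom a k ^+ n = lmonom (a ^+ n) (k *+ n).
Proof. by elim: n => // n IHn; rewrite !exprS IHn lmonomM mulrS. Qed.

Lemma mcoeff_lmonom (a : R) k l : (lmonom a k)@_l = a *+ (k == l).
Proof. exact: mcoeffU. Qed.

Lemma mcoeff_laurentM f g k : (f * g)@_k =
  \sum_(i <- msupp f) \sum_(j <- msupp g) (f@_i * g@_j) *+ (i + j == k).
Proof.
have -> : f * g = laurent_mul f g by [].
rewrite raddf_sum; apply: eq_bigr => i _; rewrite raddf_sum.
by apply: eq_bigr => j _; exact: mcoeffU.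
Qed.

Lemma mcoeff_natM n f k : (n%:R * f)@_k = n%:R * f@_k.
Proof. by rewrite !mulr_natl; exact: mcoeffMn. Qed.
End LaurentTheory.

Section Lmap.
Variables R S : comNzRingType.

Lemma lmap_is_nmod_morphism (f : {additive R -> S}) : nmod_morphism (lmap f).
Proof.
apply: (laurent_sum_is_nmod_morphism (phi := fun k c => lmonom (f c) k)) => k a b.
by rewrite raddfD lmonomD.
Qed.

HB.instance Definition _ (f : {additive R -> S}) :=
  GRing.isNmodMorphism.Build (laurent R) (laurent S) (lmap f)
    (lmap_is_nmod_morphism f).

Lemma lmap_monom (f : {additive R -> S}) c k :
  lmap f (lmonom c k) = lmonom (f c) k.
Proof.
apply: (laurent_sum_monom (phi := fun k c => lmonom (f c) k)) => {}k a b.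
by rewrite raddfD lmonomD.
Qed.

Lemma mcoeff_lmap (f : {additive R -> S}) (g : laurent R) k :
  (lmap f g)@_k = f g@_k.
Proof.
elim/laurent_ind: g => [|g h IHg IHh|c l].
- by rewrite raddf0 !mcoeff0 raddf0.
- by rewrite raddfD !mcoeffD IHg IHh raddfD.
- by rewrite lmap_monom !mcoeff_lmonom raddfMn.
Qed.

Lemma lmap_is_monoid_morphism (f : {rmorphism R -> S}) :
  monoid_morphism (lmap f).
Proof.
split=> [|g h]; first by rewrite [LHS](lmap_monom f 1 0) /= rmorph1.
elim/laurent_ind: g h => [h|g g' IHg IHg' h|c k h].
- by rewrite mul0r raddf0 mul0r.
- by rewrite mulrDl !raddfD /= IHg IHg' mulrDl.
elim/laurent_ind: h => [|h h' IHh IHh'|d l].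
- by rewrite mulr0 raddf0 mulr0.
- by rewrite mulrDr !raddfD /= IHh IHh' mulrDr.
- by rewrite lmonomM !lmap_monom lmonomM /= rmorphM.
Qed.

HB.instance Definition _ (f : {rmorphism R -> S}) :=
  GRing.isMonoidMorphism.Build (laurent R) (laurent S) (lmap f)
    (lmap_is_monoid_morphism f).

Lemma lmapM (f : {rmorphism R -> S}) (g h : laurent R) :
  lmap f (g * h) = lmap f g * lmap f h.
Proof. exact: rmorphM. Qed.

Lemma lmapXn (f : {rmorphism R -> S}) (g : laurent R) n :
  lmap f (g ^+ n) = lmap f g ^+ n.
Proof. exact: rmorphXn. Qed.
End Lmap.

(* Lexicographically maximal exponents multiply without cancellation. *)
Lemma laurent_mulf_eq0 (R : idomainType) (f g : laurent R) :
  f * g = 0 -> f = 0 \/ g = 0.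
Proof.
have lex_max (s : seq (nat * int)) : s != [::] -> exists2 k, k \in s &
    forall l, l \in s -> (l.1 < k.1)%N \/ l.1 = k.1 /\ (l.2 <= k.2)%R.
  elim: s => // -[k1 k2] s IHs _.
  have [->|/IHs[[m1 m2] ms max_m]] := eqVneq s [::].
    by exists (k1, k2) => [|l]; rewrite inE // => /eqP ->; right.
  have [le_mk|lt_km] := boolP ((m1 < k1)%N || (m1 == k1) && (m2 <= k2)%R).
    exists (k1, k2) => [|[l1 l2]]; first exact: mem_head.
    by rewrite inE => /predU1P[[-> ->]|/max_m /=]; [right | lia].
  exists (m1, m2) => [|[l1 l2]]; first by rewrite inE ms orbT.
  by rewrite inE => /predU1P[[-> ->]|/max_m //] /=; lia.
have [->|f0] := eqVneq f 0; first by left.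
have [->|g0] := eqVneq g 0; first by right.
have supp_neq0 (h : laurent R) : h != 0 -> enum_fset (msupp h) != [::].
  apply: contra_neq => h0; apply/malgP => k; rewrite mcoeff0 mcoeff_outdom //.
  by rewrite -[k \in _]/(k \in enum_fset (msupp h)) h0.
have [k kf max_k] := lex_max _ (supp_neq0 f f0).
have [l lg max_l] := lex_max _ (supp_neq0 g g0).
move=> /(congr1 (mcoeff (k + l))); rewrite mcoeff_laurentM mcoeff0.
(* By maximality, [(k, l)] is the only pair of exponents from the two supports with sum [k + l], so
   that coefficient of the product is [f@_k * g@_l]. *)
have vanish (i j : nat * int) :
    i \in msupp f -> j \in msupp g -> i + j = k + l -> i = k /\ j = l.
  move=> /max_k + /max_l; case: i j k l {kf lg max_k max_l} => [i1 i2] [j1 j2].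
  case=> [k1 k2] [l1 l2] /= le_ik le_jl [e1 e2].
  have {}e1 : (i1 + j1 = k1 + l1)%N := e1.
  by split; congr pair; lia.
rewrite (bigD1_seq k) ?fset_uniq //= (bigD1_seq l) ?fset_uniq //= eqxx.
rewrite [X in _ + X + _]big_seq_cond big1 => [|j /andP[jg jl]]; last first.
  by have [/(vanish _ _ kf jg)[_ /eqP]|//] := eqVneq; rewrite (negPf jl).
rewrite big_seq_cond big1 => [|i /andP[im ik]]; last first.
  rewrite big_seq big1 // => j jg.
  by have [/(vanish _ _ im jg)[/eqP]|//] := eqVneq; rewrite (negPf ik).
by move=> /eqP; rewrite !addr0 mulf_eq0 !mcoeff_eq0 kf lg.
Qed.

(* f(x^p, y^p) *)
Definition lfrob (R : comNzRingType) (p : nat) (f : laurent R) : laurent R :=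
  \sum_(k <- msupp f) lmonom f@_k (k *+ p).

(** * The substitution of [x^p], [y^p] and the Frobenius map *)

Section Lfrob.
Variable p : nat.

Section OneRing.
Variable R : comNzRingType.

Lemma lfrob_is_nmod_morphism : nmod_morphism (@lfrob R p).
Proof.
apply: (laurent_sum_is_nmod_morphism (phi := fun k c => lmonom c (k *+ p))) => k.
exact: lmonomD.
Qed.

HB.instance Definition _ :=
  GRing.isNmodMorphism.Build (laurent R) (laurent R) (@lfrob R p)
    lfrob_is_nmod_morphism.

Lemma lfrob_monom (c : R) k : lfrob p (lmonom c k) = lmonom c (k *+ p).
Proof.
apply: (laurent_sum_monom (phi := fun k c => lmonom c (k *+ p))) => {}k.
exact: lmonomD.
Qed.
End OneRing.

Lemma lmap_lfrob (R S : comNzRingType) (f : {additive R -> S}) (g : laurent R) :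
  lmap f (lfrob p g) = lfrob p (lmap f g).
Proof.
elim/laurent_ind: g => [|g h IHg IHh|c l]; first by rewrite !raddf0.
  by rewrite !raddfD /= IHg IHh.
by rewrite lfrob_monom !lmap_monom lfrob_monom.
Qed.

Lemma pchar_laurent_Fp : prime p -> p \in [pchar laurent 'F_p].
Proof.
move=> p_pr; rewrite inE p_pr; apply/eqP.
by rewrite -[LHS](lmonomMn (1 : 'F_p) 0) (pcharf0 (pchar_Fp p_pr)) lmonom0.
Qed.

(** In characteristic [p] the Frobenius is additive, which reduces the claim to monomials; there
    [c ^+ p = c] by Fermat. *)
Lemma laurent_Fp_exp (f : laurent 'F_p) : prime p -> f ^+ p = lfrob p f.
Proof.
move=> p_pr; rewrite -(pFrobenius_autE (pchar_laurent_Fp p_pr)).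
elim/laurent_ind: f => [|f g IHf IHg|c k]; first by rewrite !raddf0.
  by rewrite !raddfD /= IHf IHg.
rewrite lfrob_monom pFrobenius_autE lmonomX; congr lmonom.
by have := expf_card c; rewrite card_Fp.
Qed.
End Lfrob.

(** * Cartier operators *)

Section Cartier.
Variables (R : comNzRingType) (p r s : nat).

Let phi (k : nat * int) (c : R) : laurent R :=
  if (k.1 == r %[mod p])%N && (k.2 == s%:Z %[mod p%:Z])%Z
  then lmonom c (((k.1 - r) %/ p)%N, ((k.2 - s%:Z)%R %/ p%:Z)%Z) else 0.

Let phiD k : {morph phi k : a b / a + b}.
Proof.
by move=> a b; rewrite /phi; case: ifP => _; rewrite ?addr0 ?lmonomD.
Qed.

Lemma cartier_is_nmod_morphism : nmod_morphism (@cartier R p r s).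
Proof. exact: (laurent_sum_is_nmod_morphism phiD). Qed.

HB.instance Definition _ :=
  GRing.isNmodMorphism.Build (laurent R) (laurent R) (@cartier R p r s)
    cartier_is_nmod_morphism.

(** By biadditivity it suffices to take monomials: adding [p] times an exponent keeps its residues
    modulo [p] and shifts the quotients by that exponent. *)
Lemma cartierM_lfrob (f g : laurent R) : (r < p)%N ->
  cartier p r s (f * lfrob p g) = cartier p r s f * g.
Proof.
move=> ltrp; have cartier_monom c k : cartier p r s (lmonom c k) = phi k c.
  exact: (laurent_sum_monom phiD).
elim/laurent_ind: f => [|f f' IHf IHf'|c k].
- by rewrite mul0r raddf0 mul0r.
- by rewrite mulrDl !raddfD /= IHf IHf' mulrDl.
elim/laurent_ind: g => [|g g' IHg IHg'|d l].
- by rewrite raddf0 !mulr0 raddf0.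
- rewrite [lfrob p _]raddfD mulrDr [LHS]raddfD mulrDr.
  by rewrite [X in X + _ = _]IHg [X in _ + X = _]IHg'.
rewrite lfrob_monom; have -> : l *+ p = ((l.1 * p)%N, l.2 * p%:Z).
  elim: (p) => [|n IHn]; first by rewrite mulr0n muln0 mulr0.
  by rewrite mulrS IHn mulnS intS mulrDr mulr1.
rewrite lmonomM !cartier_monom /phi /=.
have -> : (k.1 + l.1 * p == r %[mod p])%N = (k.1 == r %[mod p])%N.
  by rewrite addnC modnMDl.
have -> : (k.2 + l.2 * p%:Z == s%:Z %[mod p%:Z])%Z = (k.2 == s%:Z %[mod p%:Z])%Z.
  by rewrite addrC modzMDl.
case: ifP => [/andP[/eqP kr _]|_]; last by rewrite mul0r.
(* The exponent of [x] is a natural number, so [k.1 - r] must be shown not to be truncated. *)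
have le_rk : (r <= k.1)%N by have := leq_mod k.1 p; rewrite kr modn_small.
rewrite lmonomM; congr (lmonom _ (_, _)).
  rewrite -[LHS]/((k.1 + l.1 * p - r) %/ p)%N -[RHS]/((k.1 - r) %/ p + l.1)%N.
  by rewrite addnC -addnBA // divnMDl 1?addnC //; lia.
rewrite addrAC [X in (X %/ _)%Z]addrC divzMDl; first exact: addrC.
by case: (p) ltrp.
Qed.

Lemma cartierM_lfrobX (f g : laurent R) n : (r < p)%N ->
  cartier p r s (f * lfrob p g ^+ n) = cartier p r s f * g ^+ n.
Proof.
move=> ltrp; elim: n => [|n IHn]; first by rewrite !mulr1.
by rewrite !exprSr !mulrA cartierM_lfrob // IHn.
Qed.
End Cartier.

(* The divisibility proof is an argument so that the morphism structure of the
   reduction can be inferred. *)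
Definition Zp_red_of_dvd (m n : nat)
  of ((Zp_trunc n).+2 %| (Zp_trunc m).+2)%N := @Zp_red m n.

Section ZpRedMorphism.
Variables (m n : nat) (dvd_nm : ((Zp_trunc n).+2 %| (Zp_trunc m).+2)%N).

HB.instance Definition _ :=
  GRing.isNmodMorphism.Build 'Z_m 'Z_n (Zp_red_of_dvd dvd_nm)
    (conj (Zp_red0 m n) (Zp_redD dvd_nm)).
HB.instance Definition _ :=
  GRing.isMonoidMorphism.Build 'Z_m 'Z_n (Zp_red_of_dvd dvd_nm)
    (conj (Zp_red1 m n) (Zp_redM dvd_nm)).
End ZpRedMorphism.

(** * Residues of p-adic integers and coefficients of [P/y] *)

Section PadicMod.
Variables p k : nat.

Lemma padic_mod_is_nmod_morphism : nmod_morphism (@padic_mod p k.+1).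
Proof.
split=> [|u v]; first exact: Zp_red0.
by rewrite /padic_mod Zp_redD //; exact: dvd_Zp_truncX.
Qed.

Lemma padic_mod_is_monoid_morphism : monoid_morphism (@padic_mod p k.+1).
Proof.
split=> [|u v]; first exact: Zp_red1.
by rewrite /padic_mod Zp_redM //; exact: dvd_Zp_truncX.
Qed.

HB.instance Definition _ :=
  GRing.isNmodMorphism.Build (padic_int p) 'Z_(p ^ k.+1) (@padic_mod p k.+1)
    padic_mod_is_nmod_morphism.
HB.instance Definition _ :=
  GRing.isMonoidMorphism.Build (padic_int p) 'Z_(p ^ k.+1) (@padic_mod p k.+1)
    padic_mod_is_monoid_morphism.
End PadicMod.

Lemma padic_mod_modn p k (u : padic_int p) : prime p ->
  (padic_mod k.+1 u %% p)%N = padic_mod 1 u :> nat.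
Proof.
move=> p_pr; have p_gt1 := prime_gt1 p_pr.
have dvdX j : (p %| (Zp_trunc (p ^ j.+1)).+2)%N.
  by rewrite Zp_cast ?expnS ?dvdn_mulr // -expnS -[1%N](expn0 p) ltn_exp2l.
have res_mod j : (padic_res u j %% p)%N = (padic_res u 0 %% p)%N.
  by elim: j => // j <-; rewrite -(padic_coh u j) /= modn_dvdm.
rewrite /padic_mod /= modn_dvdm // res_mod -(res_mod 1%N).
by congr modn; rewrite Zp_cast expn1 ?prime_gt1.
Qed.

Lemma mcoeff_poly_to_laurent (R : comNzRingType) (P : {poly {poly R}}) m n :
  (poly_to_laurent P)@_(m, n%:Z) = P`_n`_m.
Proof.
have coef_sum_eq (S : nzRingType) (q : {poly S}) i :
    \sum_(j < size q) q`_j *+ (j == i :> nat) = q`_i.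
  rewrite -[in RHS](coefK q) poly_def coef_sum; apply: eq_bigr => j _.
  by rewrite coefZ coefXn mulr_natr eq_sym.
rewrite -(coef_sum_eq _ P n) coef_sum raddf_sum; apply: eq_bigr => i _.
rewrite coefMn -(coef_sum_eq _ P`_i m) raddf_sum -sumrMnl; apply: eq_bigr => j _.
by rewrite /= mcoeff_lmonom xpair_eqE -mulrnA mulnb.
Qed.

Lemma mcoeff_lYinvM (R : comNzRingType) (f : laurent R) m n :
  (lYinv * f)@_(m, n) = f@_(m, n + 1).
Proof.
elim/laurent_ind: f => [|f g IHf IHg|c [i j]].
- by rewrite mulr0 !mcoeff0.
- by rewrite mulrDr !mcoeffD IHf IHg.
rewrite lmonomM mul1r !mcoeff_lmonom !xpair_eqE add0r.
by rewrite (addrC (-1)) subr_eq.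
Qed.

Lemma mcoeff_div_y00 (R : comNzRingType) (P : {poly {poly R}}) :
  (div_y P)@_(0%N, 0) = (P^`()).[0].[0].
Proof.
rewrite !horner_coef0 coef_deriv mulr1n /div_y mcoeff_lYinvM.
exact: mcoeff_poly_to_laurent.
Qed.

(** Meant for maps that need not be additive, such as quotient and remainder by [p]; [F 0 = 0] keeps
    the support finite. *)
Lemma laurent_pointwise (R : comNzRingType) (F : R -> R) (f : laurent R) :
  F 0 = 0 -> exists g : laurent R, forall k, g@_k = F f@_k.
Proof.
move=> F0; exists [malg k in msupp f => F f@_k] => k; rewrite mcoeffE.
by case: ifPn => // /mcoeff_outdom ->.
Qed.

(** * Digits and divisibility by [p] over [Z/p^(a+1)] *)

Section ModP.
Variables (p a : nat).
Hypothesis p_pr : prime p.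
Local Notation Ra := 'Z_(p ^ a.+1).
Implicit Types f g u v d : laurent Ra.

Let p_gt1 : (1 < p)%N := prime_gt1 p_pr.

Let pX_gt1 : (1 < p ^ a.+1)%N.
Proof. by rewrite -[1%N](expn0 p) ltn_exp2l. Qed.

(** The modulus [pdiv p] makes the target of [red] the field ['F_p]. *)
Let dvd_p_trunc : ((Zp_trunc (pdiv p)).+2 %| (Zp_trunc (p ^ a.+1)).+2)%N.
Proof. by rewrite Fp_cast // Zp_cast // expnS dvdn_mulr. Qed.

Local Notation red := (Zp_red_of_dvd dvd_p_trunc).
Local Notation redL := (lmap red).

Let redE (c : Ra) : red c = (c %% p)%N :> nat.
Proof. by rewrite /= Fp_cast. Qed.

Lemma natr_p_nil : p%:R ^+ a.+1 = 0 :> laurent Ra.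
Proof.
rewrite -natrX -[LHS](lmonomMn (1 : Ra) 0) -[RHS](lmonom0 _ 0); congr lmonom.
by apply/val_inj; rewrite /= val_Zp_nat // modnn.
Qed.

Lemma redL_eq0 f : redL f = 0 -> exists v, f = p%:R * v.
Proof.
move=> red_f; have [|v vE] := @laurent_pointwise _ (fun c : Ra => (c %/ p)%:R) f.
  by rewrite div0n.
exists v; apply/malgP => k; rewrite mcoeff_natM vE -natrM.
have /dvdnP[m fk] : (p %| f@_k)%N.
  rewrite /dvdn -redE -(mcoeff_lmap red) red_f.
  by rewrite mcoeff0.
by rewrite -[LHS]natr_Zp fk mulnK 1?mulnC // ltnW.
Qed.

Lemma redL_natpM v : redL (p%:R * v) = 0.
Proof. by rewrite rmorphM rmorph_nat (pcharf0 (pchar_laurent_Fp p_pr)) mul0r. Qed.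

Definition digit_laurent d : Prop := forall e, d@_e \in digits p a.+1.

Lemma digit_divp u : exists d v, digit_laurent d /\ u = d + p%:R * v.
Proof.
have [|d dE] := @laurent_pointwise _ (fun c : Ra => (c %% p)%:R) u.
  by rewrite mod0n.
have [|v uE] := @redL_eq0 (u - d).
  apply/malgP => k; rewrite mcoeff_lmap mcoeffB raddfB /= dE rmorph_nat.
  apply/eqP; rewrite mcoeff0 subr_eq0; apply/eqP/ord_inj.
  by rewrite redE val_Fp_nat // modn_mod.
exists d, v; split; last by rewrite -uE addrC subrK.
by move=> e; rewrite dE map_f // mem_iota ltn_pmod // ltnW.
Qed.

Lemma digit_laurent_inj d d' v :
  digit_laurent d -> digit_laurent d' -> d - d' = p%:R * v -> d = d'.
Proof.
move=> Dd Dd' /(congr1 redL); rewrite redL_natpM => red_dd'.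
apply/malgP => k; have /mapP[i] := Dd k; have /mapP[j] := Dd' k.
rewrite !mem_iota /= !add0n => ltjp d'k ltip dk.
have := congr1 (mcoeff k) red_dd'.
rewrite mcoeff_lmap mcoeffB raddfB /= dk d'k !rmorph_nat mcoeff0 => /eqP.
rewrite subr_eq0 => /eqP/(congr1 (@nat_of_ord _)).
by rewrite !val_Fp_nat // !modn_small // => ->.
Qed.

Lemma natp_reg k u : (k < a.+1)%N -> p%:R ^+ k * u = 0 -> exists v, u = p%:R * v.
Proof.
move=> ltka pku; apply: redL_eq0; apply/malgP => e.
rewrite mcoeff_lmap mcoeff0; apply/ord_inj; rewrite redE.
have := congr1 (mcoeff e) pku; rewrite -natrX mcoeff_natM mcoeff0.
rewrite -[u@_e in LHS]natr_Zp -natrM => /(congr1 val).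
rewrite /= val_Zp_nat //; move: (nat_of_ord u@_e) => c /eqP.
(* After cancelling [p ^ k], a positive power of [p] still divides [c], because [k <= a]. *)
have -> : (p ^ a.+1 = p ^ k * p ^ (a - k).+1)%N.
  by rewrite -expnD; congr expn; lia.
rewrite -/(_ %| _)%N dvdn_pmul2l ?expn_gt0 1?ltnW // expnS.
by move=> /(dvdn_trans (dvdn_mulr _ (dvdnn p))) /eqP.
Qed.

(** * The lift [Q] and the span containing the states *)

Variables (P : {poly {poly padic_int p}}) (Q : laurent Ra).
Hypothesis Q_lift : is_lift P Q.

(** Stated on natural representatives because [is_lift] reduces to ['Z_(p ^ 1)], whereas [red]
    reduces to ['F_p]. *)
Let Q_modp e : (Q@_e %% p)%N = padic_mod 1 (div_y P)@_e :> nat.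
Proof.
have dvd_p1 : ((Zp_trunc (p ^ 1)).+2 %| (Zp_trunc (p ^ a.+1)).+2)%N.
  by rewrite expn1 -(Fp_Zcast p_pr).
have [/(congr1 (mcoeff e)) + _] := Q_lift.
rewrite (mcoeff_lmap (Zp_red_of_dvd dvd_p1)) (mcoeff_lmap (@padic_mod p 1)).
move=> <- /=; congr modn; rewrite Zp_cast expn1 //.
Qed.

Lemma lmap_padic_mod_div_y :
  exists U, lmap (@padic_mod p a.+1) (div_y P) = Q + p%:R * U.
Proof.
have [|U UE] := @redL_eq0 (lmap (@padic_mod p a.+1) (div_y P) - Q); last first.
  by exists U; rewrite -UE addrC subrK.
apply/malgP => e; rewrite mcoeff_lmap mcoeffB mcoeff_lmap mcoeff0 raddfB.
apply/eqP; rewrite subr_eq0; apply/eqP/ord_inj; rewrite !redE Q_modp.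
by rewrite padic_mod_modn.
Qed.

Lemma Qp_lfrob : exists V, Q ^+ p = lfrob p Q + p%:R * V.
Proof.
have [|V VE] := @redL_eq0 (Q ^+ p - lfrob p Q); last first.
  by exists V; rewrite -VE addrC subrK.
by rewrite rmorphB rmorphXn /= lmap_lfrob laurent_Fp_exp // subrr.
Qed.

Let N := (p ^ a - 1)%N.

Let ltn_a_N k : (k < a.+1)%N -> (k <= N)%N.
Proof. by rewrite ltnS /N => leka; have := ltn_expl a p_gt1; lia. Qed.

Lemma init_state_span : base_span p%:R Q a.+1 N (init_state a.+1 P).
Proof.
have [U UE] := lmap_padic_mod_div_y.
rewrite /init_state subSS subn0 lmapM lmapXn [X in _ * X ^+ _]UE.
exact: base_span_mul_exprD natr_p_nil _ _.
Qed.

Lemma lambda0_span r S : (r < p)%N ->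
  base_span p%:R Q a.+1 N S -> base_span p%:R Q a.+1 N (lambda0 Q r S).
Proof.
move=> ltrp [T ->]; have [V VE] := Qp_lfrob.
rewrite /lambda0 subSS subn0 mulr_suml raddf_sum big_seq_cond /=.
apply: base_span_sum => k; rewrite mem_index_iota andbT => /andP[_ /ltn_a_N lekN].
(* Both sides equal [p ^ a.+1 - k.+1]. *)
have expE : (N - k + (p ^ a.+1 - p ^ a) = p * (N - k) + (p - 1) * k.+1)%N.
  have pa_gt0 : (0 < p ^ a)%N by rewrite expn_gt0 ltnW.
  rewrite expnS; move: pa_gt0 lekN; rewrite /N.
  by case: (p) p_gt1 => // q _; nia.
rewrite (expand_exp_congr (T k) k VE expE) raddf_sum.
(* Written as a natural multiple, [p ^ (k + i)] leaves the Cartier operator by additivity alone. The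
   power of [lfrob p Q] leaves as [Q ^+ (N - k - i)], giving the term of index [k + i]. *)
apply: base_span_sum => i _; rewrite -natrX mulr_natl raddfMn /=.
rewrite cartierM_lfrobX // -[_ *+ (p ^ _)]mulr_natl natrX mulrA.
rewrite [p%:R ^+ _ * _]mulrC -subnDA.
exact: base_span_term natr_p_nil _ _.
Qed.

Lemma state_span S : is_state P Q S -> base_span p%:R Q a.+1 N S.
Proof.
by elim=> [|r {}S ltrp _]; [exact: init_state_span | exact: lambda0_span].
Qed.

Hypothesis P_y_neq0 : padic_mod 1 (P^`()).[0].[0] <> 0.

(** Laurent polynomials over ['F_p] have no zero divisors, and [Q] is nonzero modulo [p] by its
    constant coefficient. *)
Lemma lift_reg u v : u * Q = p%:R * v -> exists w, u = p%:R * w.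
Proof.
move=> /(congr1 redL); rewrite [RHS]redL_natpM [LHS]lmapM.
move=> /(@laurent_mulf_eq0 'F_p)[/redL_eq0 //|] /(congr1 (mcoeff (0%N, 0))).
rewrite mcoeff_lmap mcoeff0 => /(congr1 (@nat_of_ord _)).
rewrite redE Q_modp mcoeff_div_y00 => P0.
by case: P_y_neq0; apply/ord_inj.
Qed.
End ModP.

Theorem theorem17 (p alpha : nat) (P : {poly {poly padic_int p}})
    (Q : laurent 'Z_(p ^ alpha)) :
  prime p -> (1 <= alpha)%N ->
  P.[0].[0] = 0 -> padic_mod 1 (P^`()).[0].[0] <> 0 ->
  is_lift P Q ->
  forall S : laurent 'Z_(p ^ alpha), is_state P Q S ->
  exists! T : {ffun 'I_alpha -> laurent 'Z_(p ^ alpha)}, is_base_repr Q S T.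
Proof.
case: alpha Q => // a Q p_pr _ _ Py0 Q_lift S stS.
have le_aN : (a.+1 <= (p ^ a - 1).+1)%N.
  by have := ltn_expl a (prime_gt1 p_pr); lia.
have [T [DT ST]] := base_expansion_exists (natr_p_nil a p_pr) le_aN
  (digit_divp p_pr) (state_span p_pr Q_lift stS).
rewrite /is_base_repr subSS subn0; exists T; split=> [|T' [DT' ST']].
  by split; [exact: DT | exact: ST].
apply: (base_expansion_uniq (D := @digit_laurent p a) (N := (p ^ a - 1)%N)
  (@digit_laurent_inj p a p_pr) (natp_reg p_pr) (lift_reg p_pr Q_lift Py0)
  DT DT').
exact: etrans (esym ST) ST'.
Qed.
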